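(* Let $\lambda>0$ and $1\le q\le2$, and take $h(\lambda,q)=\lambda^{1-q}$ in the definition of the Tsallis hypoentropies. Let $X$ and $Y$ be discrete random variables with $n$ and $m$ values respectively and joint probabilities $p(x_i,y_j)$. Then $$H_{\lambda,q}(X,Y)\le H_{\lambda,q}(X)+H_{\lambda,q}(Y).$$
   Context: The $q$-logarithm is $\ln_q(x)=\frac{x^{1-q}-1}{1-q}$ for $x>0$, $q\neq 1$, with $\ln_1=\log$ (the limit $q\to1$). Marginals are $p(x_i)=\sum_j p(x_i,y_j)$, $p(y_j)=\sum_i p(x_i,y_j)$. With $h(\lambda,q)=\lambda^{1-q}$, $$H_{\lambda,q}(X)=\lambda^{-q}\left\{-(1+\lambda)\ln_q\frac{1}{1+\lambda}+\sum_{i=1}^n(1+\lambda p(x_i))\ln_q\frac{1}{1+\lambda p(x_i)}\right\}$$ (and similarly for $Y$), and the joint Tsallis hypoentropy is $$H_{\lambda,q}(X,Y)=\lambda^{-q}\left\{-(1+\lambda)\ln_q\frac{1}{1+\lambda}+\sum_{i=1}^n\sum_{j=1}^m(1+\lambda p(x_i,y_j))\ln_q\frac{1}{1+\lambda p(x_i,y_j)}\right\}.$$ *)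

(* Defs.v *)
From HB Require Import structures.
From mathcomp Require Import all_boot all_order all_algebra.
From mathcomp Require Import reals exp.

Set Implicit Arguments.
Unset Strict Implicit.
Unset Printing Implicit Defensive.

Import Order.TTheory GRing.Theory Num.Theory.
Local Open Scope ring_scope.

(* Only used at positive arguments; [powR] and [ln] are total. *)
Definition lnq (R : realType) (q x : R) : R :=
  if q == 1 then ln x else (powR x (1 - q) - 1) / (1 - q).

(* Joint law of (X, Y): [p i j] is the probability p(x_i, y_j). *)
Definition joint_pmf (R : realType) (n m : nat) (p : 'I_n -> 'I_m -> R) : Prop :=
  (forall i j, 0 <= p i j) /\ \sum_(i < n) \sum_(j < m) p i j = 1.

Definition marginalX (R : realType) (n m : nat) (p : 'I_n -> 'I_m -> R)
  (i : 'I_n) : R := \sum_(j < m) p i j.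

Definition marginalY (R : realType) (n m : nat) (p : 'I_n -> 'I_m -> R)
  (j : 'I_m) : R := \sum_(i < n) p i j.

(* The prefactor l^(-q) is h(l, q) / l for the normalisation h(l, q) = l^(1-q). *)
Definition hypoentropy (R : realType) (l q : R) (n : nat) (p : 'I_n -> R) : R :=
  powR l (- q) *
  (- (1 + l) * lnq q (1 / (1 + l)) +
   \sum_(i < n) (1 + l * p i) * lnq q (1 / (1 + l * p i))).

Definition joint_hypoentropy (R : realType) (l q : R) (n m : nat)
    (p : 'I_n -> 'I_m -> R) : R :=
  powR l (- q) *
  (- (1 + l) * lnq q (1 / (1 + l)) +
   \sum_(i < n) \sum_(j < m)
     (1 + l * p i j) * lnq q (1 / (1 + l * p i j))).

(* Main.v *)
(* With g(u) = - (1 + l u) ln_q (1 / (1 + l u)) = (1 + l u) ln_{2-q} (1 + l u), the claim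
   is sum_i g(r_i) + sum_j g(s_j) <= sum_ij g(p_ij) + g(1), where r and s are the
   marginals.  For r, u in [0, 1] one has
     r g(u) + u g(r) <= g(r u) + r u g(1):
   replacing g(x) by g(x t) and differentiating in t, this reduces to
     L(1 + l u) + L(1 + l r) <= L(1 + l r u) + L(1 + l),   L = ln_{2-q},
   which holds because (1 + l u)(1 + l r) <= (1 + l r u)(1 + l).  Take r = r_i and
   u = p_ij / r_i, bound g(u) from below by the tangent line of the convex function g
   at s_j = sum_i r_i (p_ij / r_i), and sum over i and j: the linear terms cancel. *)
Require Import Defs.
From mathcomp Require Import all_boot all_order all_algebra.
From mathcomp Require Import reals exp.
From mathcomp Require Import boolp functions normedtype derive realfun.
From mathcomp Require Import ring lra.
Set Implicit Arguments.
Unset Strict Implicit.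
Unset Printing Implicit Defensive.

Import Order.TTheory GRing.Theory Num.Theory.
Import numFieldNormedType.Exports.
Local Open Scope ring_scope.

Section LnqProperties.
Context {R : realType}.
Implicit Types k x y : R.

Lemma lnq1 k : lnq k 1 = 0.
Proof. by rewrite /lnq; case: ifP => _; rewrite ?ln1// powR1 subrr mul0r. Qed.

(** The duality that turns the reciprocals in the entropies into plain arguments, at the cost of a
    sign and of the parameter [2 - k]. *)
Lemma lnq_inv k x : 0 < x -> lnq k (1 / x) = - lnq (2 - k) x.
Proof.
move=> x0; rewrite /lnq div1r.
have -> : (2 - k == 1) = (k == 1) by apply/eqP/eqP => ?; lra.
case: eqP => k1; first by rewrite lnV.
have -> : 1 - (2 - k) = - (1 - k) by ring.
rewrite invrN mulrN opprK; congr ((_ - 1) / _).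
by rewrite -powR_inv1 ?ltW// -powRrM mulN1r.
Qed.

Lemma lnq_le k x y : k <= 1 -> 0 < x -> x <= y -> lnq k x <= lnq k y.
Proof.
move=> k1 x0 xy; have y0 := lt_le_trans x0 xy.
rewrite /lnq; case: eqVneq => [_|kn1]; first by rewrite ler_ln ?posrE.
apply: ler_wpM2r; first by rewrite invr_ge0 subr_ge0.
by rewrite lerD2r ge0_ler_powR ?nnegrE ?subr_ge0 ?(ltW x0) ?(ltW y0).
Qed.

(** For [k = 1] this is the logarithm of [b * c <= a * d]. Otherwise let [A], [B], [C], [D] be the
    powers with exponent [1 - k]: then [A * (A + D - B - C)] is at least [(B - A) * (C - A)], which
    is nonnegative. *)
Lemma lnq_exchange k (a b c d : R) : k <= 1 -> 0 < a -> a <= b -> a <= c ->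
  b * c <= a * d -> lnq k b + lnq k c <= lnq k a + lnq k d.
Proof.
move=> k1 a0 ab ac bcad; have b0 := lt_le_trans a0 ab.
have c0 := lt_le_trans a0 ac.
have d0 : 0 < d by rewrite -(pmulr_rgt0 _ a0) (lt_le_trans _ bcad)// mulr_gt0.
rewrite /lnq; case: eqVneq => [_|kn1].
  by rewrite -!lnM ?posrE// ler_ln ?posrE ?mulr_gt0.
rewrite -!mulrDl; apply: ler_wpM2r; first by rewrite invr_ge0 subr_ge0.
set e := 1 - k; have e0 : 0 <= e by rewrite /e; lra.
have A0 : 0 < a `^ e by exact: powR_gt0.
have AB : a `^ e <= b `^ e by rewrite ge0_ler_powR ?nnegrE ?(ltW a0) ?(ltW b0) ?(ltW c0).
have AC : a `^ e <= c `^ e by rewrite ge0_ler_powR ?nnegrE ?(ltW a0) ?(ltW b0) ?(ltW c0).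
have : b `^ e * c `^ e <= a `^ e * d `^ e.
  by rewrite -!powRM ?(ltW a0) ?(ltW b0) ?(ltW c0) ?(ltW d0)// ge0_ler_powR//
    nnegrE mulr_ge0 ?(ltW a0) ?(ltW b0) ?(ltW c0) ?(ltW d0).
move: A0 AB AC; move: (a `^ e) (b `^ e) (c `^ e) (d `^ e) => A B C D A0 AB AC H.
suff : B + C <= A + D by lra.
rewrite -(ler_pM2l A0).
have := mulr_ge0 (x := B - A) (y := C - A); rewrite !subr_ge0 => /(_ AB AC); nra.
Qed.

(** Writing the derivative through [lnq] gives one formula for all [k] and lets order properties of
    [lnq] pass to derivatives. *)
Lemma is_derive_mul_lnq k x : 0 < x ->
  is_derive x (1 : R) (fun z => z * lnq k z) (1 + (2 - k) * lnq k x).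
Proof.
move=> x0; rewrite /lnq; case: eqVneq => [->|kn1].
  have H := is_derive1_ln x0.
  have -> : (fun z => z * ln z) = id * (@ln R) by [].
  apply: is_derive_eq; rewrite /GRing.scale/=.
  by rewrite mulfV ?gt_eqF//; ring.
have k1 : 1 - k != 0 by rewrite subr_eq0 eq_sym.
have H := is_derive1_powR (1 - k) x0.
have -> : (fun z => z * ((z `^ (1 - k) - 1) / (1 - k))) =
  id * ((1 - k)^-1 \*: ((@powR R)^~ (1 - k) - cst 1)).
  by apply/funext => z /=; rewrite /GRing.mul/= /GRing.scale/=
    mulrC [X in X * _]mulrC mulrC.
apply: is_derive_eq; rewrite !fctE /GRing.scale/= -[_ *: _]/(_ * _).
have -> : x `^ (1 - k - 1) = x `^ (1 - k) / x.
  by rewrite powRB ?powRr1 ?(ltW x0)// (gt_eqF x0) implybT.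
by field; rewrite k1 gt_eqF.
Qed.

End LnqProperties.

Lemma MVT_itv (R : realType) (f df : R -> R) (x y : R) : x <= y ->
  (forall z, x <= z -> is_derive z (1 : R) f (df z)) ->
  exists2 c, x <= c <= y & f y - f x = df c * (y - x).
Proof.
move=> xy fdf; apply: MVT_segment => // [z|].
  by rewrite in_itv/= => /andP[/ltW xz _]; exact: fdf.
apply: derivable_within_continuous => z; rewrite in_itv/= => /andP[xz _].
by have [] := fdf _ xz.
Qed.

Section ShiftedMulLnq.
Context {R : realType}.
Variables l k : R.
Hypotheses (l0 : 0 <= l) (k1 : k <= 1).

Let g (u : R) := (1 + l * u) * lnq k (1 + l * u).

(** Convexity: the derivative is nondecreasing, so the mean-value slope between [x] and [y] compares
    with the slope at [y]. *)
Lemma mul_lnq_tangent (x y : R) : 0 < x -> 0 < y ->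
  y * lnq k y + (1 + (2 - k) * lnq k y) * (x - y) <= x * lnq k x.
Proof.
move=> x0 y0.
have dlnq (z t : R) : 0 < z -> z <= t -> (2 - k) * lnq k z <= (2 - k) * lnq k t.
  by move=> z0 zt; apply: ler_wpM2l; [have := k1; lra|exact: lnq_le].
have drv (a z : R) (a0 : 0 < a) (az : a <= z) := is_derive_mul_lnq k (lt_le_trans a0 az).
case: (lerP x y) => xy.
  have [c /andP[xc cy] e] := MVT_itv xy (drv x ^~ x0).
  by have := dlnq _ _ (lt_le_trans x0 xc) cy; nra.
have [c /andP[yc cx] e] := MVT_itv (ltW xy) (drv y ^~ y0).
by have := dlnq _ _ y0 yc; nra.
Qed.

Lemma is_derive_shifted_mul_lnq (c t : R) : 0 <= c -> 0 <= t ->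
  is_derive t (1 : R) (fun t => g (c * t)) (l * c * (1 + (2 - k) * lnq k (1 + l * (c * t)))).
Proof.
move=> c0 t0.
have x0 : 0 < 1 + l * (c * t) by rewrite ltr_pwDl// !mulr_ge0.
have H := is_derive_mul_lnq k x0.
have K : is_derive t (1 : R) (fun t => 1 + l * (c * t)) (l * c).
  have -> : (fun t => 1 + l * (c * t)) = cst 1 + (l * c) \*: id.
    by apply/funext => z; rewrite !fctE/= /GRing.scale/= mulrA.
  by apply: is_derive_eq; rewrite /GRing.scale/=; ring.
have := @is_derive1_comp _ (fun z => z * lnq k z) (fun t => 1 + l * (c * t)) t _ _ H K.
by rewrite mulrC.
Qed.

Lemma shifted_mul_lnq_exchange (r u : R) : 0 <= r <= 1 -> 0 <= u <= 1 ->
  r * g u + u * g r <= g (r * u) + r * u * g 1.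
Proof.
move=> /andP[r0 r1] /andP[u0 u1].
have ru0 : 0 <= r * u by exact: mulr_ge0.
pose L (c t : R) := 1 + (2 - k) * lnq k (1 + l * (c * t)).
(* The defect of the claim with all arguments scaled by [t]. It vanishes at 0, so the sign of its
   derivative decides; the weights give all four derivatives the common factor [l * (r * u)]. *)
pose F (t : R) := g (r * u * t) + r * u * g (1 * t) - r * g (u * t) - u * g (r * t).
have dF (t : R) : 0 <= t -> is_derive t (1 : R) F
    (l * (r * u) * (L (r * u) t + L 1 t - L u t - L r t)).
  move=> t0.
  have Hru := is_derive_shifted_mul_lnq ru0 t0.
  have H1 := is_derive_shifted_mul_lnq ler01 t0.
  have Hr := is_derive_shifted_mul_lnq r0 t0.
  have Hu := is_derive_shifted_mul_lnq u0 t0.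
  have -> : F = (fun t => g (r * u * t)) + (r * u) \*: (fun t => g (1 * t))
      - r \*: (fun t => g (u * t)) - u \*: (fun t => g (r * t)) by [].
  by apply: is_derive_eq; rewrite /L /GRing.scale/=; ring.
have [c /andP[c0 _]] := MVT_itv ler01 dF.
have -> : F 0 = 0 by rewrite /F /g !mulr0 addr0 lnq1; ring.
rewrite !subr0 mulr1 => Fc.
suff : 0 <= F 1 by rewrite /F !mulr1; lra.
rewrite Fc mulr_ge0//; first by rewrite mulr_ge0.
have lc0 : 0 <= l * c by exact: mulr_ge0.
have ruu : r * u <= u by rewrite ler_piMl.
have rur : r * u <= r by rewrite ler_piMr.
have : lnq k (1 + l * (u * c)) + lnq k (1 + l * (r * c)) <=
    lnq k (1 + l * (r * u * c)) + lnq k (1 + l * (1 * c)).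
  apply: lnq_exchange => //.
  - by rewrite ltr_pwDl// !mulr_ge0.
  - by rewrite lerD2l ler_wpM2l// ler_wpM2r.
  - by rewrite lerD2l ler_wpM2l// ler_wpM2r.
  rewrite -subr_ge0.
  have -> : (1 + l * (r * u * c)) * (1 + l * (1 * c)) -
    (1 + l * (u * c)) * (1 + l * (r * c)) = l * c * ((1 - r) * (1 - u)) by ring.
  by rewrite mulr_ge0// mulr_ge0 ?subr_ge0.
have k2 : 0 <= 2 - k by have := k1; lra.
by rewrite /L; nra.
Qed.

(** The slope is the derivative of [g] at [v]; what matters later is that it does not depend on
    [u]. *)
Lemma shifted_mul_lnq_tangent (v : R) : 0 <= v ->
  exists c, forall u, 0 <= u -> g v + c * (u - v) <= g u.
Proof.
move=> v0; exists (l * (1 + (2 - k) * lnq k (1 + l * v))) => u u0.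
have pos w : 0 <= w -> 0 < 1 + l * w by move=> w0; rewrite ltr_pwDl// mulr_ge0.
have := mul_lnq_tangent (pos _ u0) (pos _ v0).
by rewrite /g; congr (_ + _ <= _); ring.
Qed.

End ShiftedMulLnq.

Lemma sum_joint_marginal_le (R : realType) (n m : nat) (p : 'I_n -> 'I_m -> R)
    (g : R -> R) : joint_pmf p -> g 0 = 0 ->
  (forall r u, 0 <= r <= 1 -> 0 <= u <= 1 ->
    r * g u + u * g r <= g (r * u) + r * u * g 1) ->
  (forall v, 0 <= v -> exists c, forall u, 0 <= u -> g v + c * (u - v) <= g u) ->
  \sum_i g (marginalX p i) + \sum_j g (marginalY p j)
    <= \sum_i \sum_j g (p i j) + g 1.
Proof.
move=> [p0 p1] g0 gM gT.
have X0 i : 0 <= marginalX p i by apply: sumr_ge0 => j _.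
have Y0 j : 0 <= marginalY p j by apply: sumr_ge0 => i _.
have X1 i : marginalX p i <= 1.
  by rewrite -p1 (bigD1 i)//= lerDl sumr_ge0// => i' _; exact: sumr_ge0.
have pX i j : p i j <= marginalX p i.
  by rewrite /marginalX (bigD1 j)//= lerDl sumr_ge0.
have sY : \sum_j marginalY p j = 1 by rewrite exchange_big.
(* One slope per column, shared by all rows: this is what makes the linear terms cancel in
   [lin0]. *)
have [c cP] := boolp.choice (fun j => gT _ (Y0 j)).
have row i : marginalX p i * (\sum_j g (marginalY p j)) +
    \sum_j c j * (p i j - marginalX p i * marginalY p j) +
    g (marginalX p i) - marginalX p i * g 1 <= \sum_j g (p i j).
  (* In a row of zero mass the quotient [p i j / marginalX p i] is no conditional probability, but
     all entries vanish and both sides are 0. *)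
  have [Xi0|Xi0] := eqVneq (marginalX p i) 0.
    have pij j : p i j = 0 by apply/eqP; rewrite eq_le p0 -Xi0 pX.
    rewrite Xi0 g0 !mul0r !add0r !subr0 addr0 !big1// => j _; rewrite pij//.
    by rewrite mul0r subr0 mulr0.
  have Xp : 0 < marginalX p i by rewrite lt_def Xi0 X0.
  have entry j : marginalX p i * g (marginalY p j) +
      c j * (p i j - marginalX p i * marginalY p j) +
      p i j / marginalX p i * g (marginalX p i) - p i j * g 1 <= g (p i j).
    have u0 : 0 <= p i j / marginalX p i by rewrite divr_ge0.
    have u1 : p i j / marginalX p i <= 1 by rewrite ler_pdivrMr// mul1r.
    have := gM (marginalX p i) (p i j / marginalX p i).
    rewrite X0 X1 u0 u1 => /(_ isT isT).
    rewrite [marginalX p i * (_ / _)]mulrC divfK// => H1.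
    have := ler_wpM2l (X0 i) (cP j _ u0).
    rewrite mulrDr [X in _ + X]mulrCA mulrBr [marginalX p i * (_ / _)]mulrC divfK//.
    lra.
  apply: le_trans (ler_sum _ (fun j _ => entry j)).
  rewrite big_split/= big_split/= big_split/= -mulr_sumr sumrN -!mulr_suml.
  by rewrite -/(marginalX p i) divff// mul1r.
have sX : \sum_i marginalX p i = 1 by [].
have lin0 : \sum_i \sum_j c j * (p i j - marginalX p i * marginalY p j) = 0.
  rewrite exchange_big/= big1// => j _.
  by rewrite -mulr_sumr sumrB -mulr_suml sX mul1r subrr mulr0.
(* The row weights sum to 1, so the column sum and [g 1] each survive exactly once. *)
have := ler_sum (index_enum _) (fun i (_ : true) => row i).
rewrite big_split/= big_split/= big_split/= sumrN -!mulr_suml sX lin0; lra.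
Qed.

Theorem corollary4p5 (R : realType) (l q : R) (n m : nat)
    (p : 'I_n -> 'I_m -> R) (hl : 0 < l) (hq1 : 1 <= q) (hq2 : q <= 2)
    (hp : joint_pmf p) :
  joint_hypoentropy l q p
    <= hypoentropy l q (marginalX p) + hypoentropy l q (marginalY p).
Proof.
have k1 : 2 - q <= 1 by lra.
pose g u := (1 + l * u) * lnq (2 - q) (1 + l * u).
have gE u : 0 <= u -> (1 + l * u) * lnq q (1 / (1 + l * u)) = - g u.
  by move=> u0; rewrite lnq_inv ?mulrN// ltr_pwDl// mulr_ge0// ltW.
(* The constant term of each entropy is [g 1]: it occurs twice on the right and once on the left,
   which leaves the single [g 1] of the sum inequality. *)
have g1 : - (1 + l) * lnq q (1 / (1 + l)) = g 1.
  by have := gE _ ler01; rewrite mulr1 => H; rewrite mulNr H opprK.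
have g0 : g 0 = 0 by rewrite /g mulr0 addr0 lnq1 mulr0.
have [p0 _] := hp.
have := sum_joint_marginal_le hp g0 (shifted_mul_lnq_exchange (ltW hl) k1)
  (shifted_mul_lnq_tangent (ltW hl) k1).
rewrite /joint_hypoentropy /hypoentropy -mulrDr g1 => H.
rewrite ler_wpM2l ?powR_ge0//.
under eq_bigr do under eq_bigr do rewrite gE//.
under [X in _ <= _ + X + _]eq_bigr do rewrite gE ?sumr_ge0//.
under [X in _ <= _ + (_ + X)]eq_bigr do rewrite gE ?sumr_ge0//.
under eq_bigr do rewrite sumrN.
rewrite !sumrN; lra.
Qed.
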